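(* If $G$ is a $3$-free digraph on $n$ vertices, then $P_4(G) \leq \frac{4}{75}n^4$.
   Context: Digraphs are finite, loopless, with at most one edge $uv$ per ordered pair. A digraph is $3$-free if it has no directed cycle of length at most $3$. $P_4(G)$ is the number of directed paths with $4$ vertices in $G$, i.e. the number of sequences $(v_1,v_2,v_3,v_4)$ of distinct vertices with $v_iv_{i+1}\in E(G)$ for $i=1,2,3$. *)

(* Defs.v *)
From mathcomp Require Import all_boot.
Set Implicit Arguments. Unset Strict Implicit. Unset Printing Implicit Defensive.

(* A digraph on vertex set T is a relation e : rel T ("e u v" = edge uv);
   at most one edge per ordered pair is automatic. *)
Definition loopless (T : finType) (e : rel T) : Prop := forall v, ~~ e v v.

Definition three_free (T : finType) (e : rel T) : Prop :=
  (forall v, ~~ e v v) /\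
  (forall u v, ~~ (e u v && e v u)) /\
  (forall u v w, ~~ [&& e u v, e v w & e w u]).

Definition P4 (T : finType) (e : rel T) : nat :=
  #|[set p : T * T * T * T |
      let: (v1, v2, v3, v4) := p in
      uniq [:: v1; v2; v3; v4] && [&& e v1 v2, e v2 v3 & e v3 v4]]|.

(* Main.v *)
Require Import Defs.
From mathcomp Require Import all_boot.
From mathcomp Require Import all_order all_algebra zify.
Import Order.TTheory GRing.Theory Num.Theory.

(** The proof is a flag-algebra certificate using two squares.  For an edge uv
    let ext(u,v,w) be 1 if u -> v -> w is an induced path, -1 if w -> u -> v is
    one, and 0 otherwise; for nonadjacent u, v let sep(u,v,w) be 1 if w is
    adjacent to exactly one of u, v, -1 if w is the middle of a directed path
    joining u and v, and 0 otherwise.  Then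
      29 [u -> v -> w -> x] + 12 [uv edge] ext(u,v,w) ext(u,v,x)
                            + 2 [u, v nonadjacent] sep(u,v,w) sep(u,v,x),
    summed over the 24 orderings of four vertices, is at most 37 in every 3-free
    digraph.  Quadruples with repetitions obey the same bound, as repeated
    vertices behave like nonadjacent twins.  Summing over all quadruples, the last
    two terms give sums of squares, hence 24 * 29 * P4 <= 37 n^4, and
    37 / 696 < 4 / 75. *)

Section FourVertexPatterns.
Set Implicit Arguments. Unset Strict Implicit. Unset Printing Implicit Defensive.
Local Open Scope ring_scope.

Definition adj (X : Type) (e : rel X) (u v : X) : bool := e u v || e v u.

Definition ext (X : Type) (e : rel X) (u v w : X) : int :=
  (e v w && ~~ adj e u w)%:R - (e w u && ~~ adj e v w)%:R.

Definition sep (X : Type) (e : rel X) (u v w : X) : int :=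
  (adj e u w (+) adj e v w)%:R - (e u w && e w v || e v w && e w u)%:R.

Definition path4 (X : Type) (e : rel X) (p : X * X * X * X) : bool :=
  let: (u, v, w, x) := p in [&& e u v, e v w & e w x].

Definition weight (X : Type) (e : rel X) (p : X * X * X * X) : int :=
  let: (u, v, w, x) := p in
  (path4 e p)%:R * 29 + (e u v)%:R * (ext e u v w * ext e u v x) * 12
  + (~~ adj e u v)%:R * (sep e u v w * sep e u v x) * 2.

Definition swap12 (X : Type) (p : X * X * X * X) :=
  let: (a, b, c, d) := p in (b, a, c, d).
Definition swap13 (X : Type) (p : X * X * X * X) :=
  let: (a, b, c, d) := p in (c, b, a, d).
Definition swap14 (X : Type) (p : X * X * X * X) :=
  let: (a, b, c, d) := p in (d, b, c, a).
Definition swap23 (X : Type) (p : X * X * X * X) :=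
  let: (a, b, c, d) := p in (a, c, b, d).
Definition swap24 (X : Type) (p : X * X * X * X) :=
  let: (a, b, c, d) := p in (a, d, c, b).
Definition swap34 (X : Type) (p : X * X * X * X) :=
  let: (a, b, c, d) := p in (a, b, d, c).

(* Coset representatives of S2 in S3 and of S3 in S4: together the three
   operators run over all 24 orderings. *)
Definition sym2 (X : Type) (f : X * X * X * X -> int) p := f p + f (swap12 p).
Definition sym3 (X : Type) (f : X * X * X * X -> int) p :=
  sym2 f p + sym2 f (swap13 p) + sym2 f (swap23 p).
Definition sym4 (X : Type) (f : X * X * X * X -> int) p :=
  sym3 f p + sym3 f (swap14 p) + sym3 f (swap24 p) + sym3 f (swap34 p).

Lemma sum_involution (I : finType) (s : I -> I) (f : I -> int) :
  involutive s -> \sum_p f (s p) = \sum_p f p.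
Proof. by move=> sK; rewrite [RHS](reindex_inj (inv_inj sK)). Qed.

Lemma sum_sym4 (T : finType) (f : T * T * T * T -> int) :
  \sum_p sym4 f p = (\sum_p f p) * 24.
Proof.
have K12 : involutive (@swap12 T) by case=> [[[]]].
have K13 : involutive (@swap13 T) by case=> [[[]]].
have K14 : involutive (@swap14 T) by case=> [[[]]].
have K23 : involutive (@swap23 T) by case=> [[[]]].
have K24 : involutive (@swap24 T) by case=> [[[]]].
have K34 : involutive (@swap34 T) by case=> [[[]]].
have s2 : \sum_p sym2 f p = (\sum_p f p) * 2.
  by rewrite big_split /= (sum_involution _ K12) mulr_natr mulr2n.
have s3 : \sum_p sym3 f p = (\sum_p sym2 f p) * 3.
  by rewrite 2!big_split /= (sum_involution _ K13) (sum_involution _ K23)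
    mulr_natr !mulrSr mulr0n add0r.
have s4 : \sum_p sym4 f p = (\sum_p sym3 f p) * 4.
  rewrite 3!big_split /= (sum_involution _ K14) (sum_involution _ K24).
  by rewrite (sum_involution _ K34) mulr_natr !mulrSr mulr0n add0r.
by rewrite s4 s3 s2 -!mulrA.
Qed.

(** With the first two entries fixed, the double sum over the last two factors as a square. *)
Lemma sum_square_ge0 (T : finType) (k : T -> T -> bool) (g : T -> T -> T -> int) :
  0 <= \sum_(p : T * T * T * T)
    (k p.1.1.1 p.1.1.2)%:R * (g p.1.1.1 p.1.1.2 p.1.2 * g p.1.1.1 p.1.1.2 p.2).
Proof.
pose F (q : T * T) w x : int := (k q.1 q.2)%:R * (g q.1 q.2 w * g q.1 q.2 x).
rewrite -(pair_bigA _ (fun q x => F q.1 q.2 x)).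
rewrite -(pair_bigA _ (fun q w => \sum_x F q w x)) /=.
apply: sumr_ge0 => q _.
have -> : \sum_w \sum_x F q w x = (k q.1 q.2)%:R * (\sum_w g q.1 q.2 w) ^+ 2.
  rewrite expr2 mulr_suml mulr_sumr; apply: eq_bigr => w _.
  by rewrite !mulr_sumr.
by rewrite mulr_ge0 ?ler0n ?sqr_ge0.
Qed.

Lemma P4_le_sum_weight (T : finType) (e : rel T) :
  (P4 e)%:R * 29 <= \sum_p weight e p.
Proof.
have -> : \sum_p weight e p =
    (\sum_p (path4 e p)%:R) * 29
    + (\sum_(p : T * T * T * T) (e p.1.1.1 p.1.1.2)%:R *
         (ext e p.1.1.1 p.1.1.2 p.1.2 * ext e p.1.1.1 p.1.1.2 p.2)) * 12
    + (\sum_(p : T * T * T * T) (~~ adj e p.1.1.1 p.1.1.2)%:R *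
         (sep e p.1.1.1 p.1.1.2 p.1.2 * sep e p.1.1.1 p.1.1.2 p.2)) * 2.
  by rewrite !mulr_suml -!big_split; apply: eq_bigr => -[[[]]].
have := sum_square_ge0 e (ext e).
have := sum_square_ge0 (fun u v => ~~ adj e u v) (sep e).
suff : (P4 e)%:R <= \sum_p (path4 e p)%:R :> int by lia.
(* [path4] does not ask for distinct vertices, so its sum can only exceed [P4]. *)
rewrite -natr_sum ler_nat /P4 -sum1_card big_mkcond /=.
by apply: leq_sum => -[[[u v] w] x] _; rewrite inE; rewrite /path4; case: ifP => // /andP[_ ->].
Qed.

(* [s] lists the twelve off-diagonal entries of a 4 x 4 matrix, row by row. *)
Definition rel_of_bits (s : seq bool) (i j : nat) : bool :=
  (i != j) && nth false s (3 * i + (j - (i < j)))%N.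

Definition three_free4 (r : rel nat) : bool :=
  let I := iota 0 4 in
  all (fun i => all (fun j => ~~ (r i j && r j i) &&
    all (fun k => ~~ [&& r i j, r j k & r k i]) I) I) I.

Fixpoint all_bits (n : nat) (P : pred (seq bool)) : bool :=
  if n is n'.+1 then all_bits n' (fun s => P (true :: s) && P (false :: s))
  else P [::].

Lemma all_bitsP (P : pred (seq bool)) (s : seq bool) :
  all_bits (size s) P -> P s.
Proof.
by elim: s P => //= b s IHs P /IHs /andP[]; case: b.
Qed.

Lemma pattern_bound :
  all_bits 12 (fun s => three_free4 (rel_of_bits s) ==>
    (sym4 (weight (rel_of_bits s)) (0, 1, 2, 3)%N <= 37)).
Proof. by vm_compute. Qed.

(** [weight] reads [e] only at pairs of distinct positions, so the twelve bits in [s] determine the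
    value by computation; equal entries of [p] just give a pattern with a nonadjacent pair. *)
Lemma sym4_weight_le (T : finType) (e : rel T) (p : T * T * T * T) :
  three_free e -> sym4 (weight e) p <= 37.
Proof.
case: p => [[[a b] c] d] [_ [e2 e3]].
pose s := [:: e a b; e a c; e a d; e b a; e b c; e b d;
              e c a; e c b; e c d; e d a; e d b; e d c].
have /implyP/(_ _) bound := all_bitsP (s := s) pattern_bound.
apply: bound; rewrite /three_free4 /= /rel_of_bits /= ?andbF.
by rewrite ?e2 ?e3.
Qed.

End FourVertexPatterns.

(* P4(G) <= (4/75) n^4, stated over nat as 75 * P4(G) <= 4 * n^4. *)
Theorem theorem2 (T : finType) (e : rel T) :
  loopless e -> three_free e -> 75 * P4 e <= 4 * #|T| ^ 4.
Proof.
move=> _ free.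
have := P4_le_sum_weight e.
have : (\sum_p sym4 (weight e) p <= \sum_(p : T * T * T * T) 37)%R.
  by apply: ler_sum => p _; apply: sym4_weight_le.
rewrite sum_sym4 sumr_const !card_prod.
have -> : (#|T| * #|T| * #|T| * #|T| = #|T| ^ 4)%N by rewrite !expnS expn0; lia.
lia.
Qed.
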